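(* Let $G\sim\mathrm{SBM}(n,\alpha\log(n)/n,\beta\log(n)/n)$ for fixed $\alpha,\beta>0$. Fix an integer $k\ge1$, and let $F$ be the set of vertices of $G$ that lie outside the $k$-core of $G$. Then, with probability $1-o(1)$ as $n\to\infty$, $$|F|\le n^{1-(\alpha+\beta)/2+o(1)} .$$
   Context: $\mathrm{SBM}(n,p,q)$: a random graph on $[n]=\{1,\dots,n\}$. Each vertex $i$ has a label $\sigma_*(i)\in\{+1,-1\}$, i.i.d. uniform. Given the labels, edges are present independently, $\{i,j\}$ with probability $p$ if $\sigma_*(i)=\sigma_*(j)$ and $q$ otherwise. The number $n$ is taken large enough that the edge probabilities are at most $1$; $\log$ is natural. The $k$-core of a graph is its largest induced subgraph in which every vertex has degree at least $k$ (possibly empty). The notation $n^{c+o(1)}$ means $n^{c+\varepsilon_n}$ for some deterministic sequence $\varepsilon_n\to0$ (depending only on $\alpha,\beta,k$). *)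

(* Defs.v *)
From mathcomp Require Import all_boot all_order all_algebra.
From mathcomp Require Import all_classical all_reals all_analysis.

Set Implicit Arguments.
Unset Strict Implicit.
Unset Printing Implicit Defensive.

Import Order.TTheory GRing.Theory Num.Theory.
Import numFieldNormedType.Exports.

Local Open Scope ring_scope.

(* An unordered pair {i, j} of distinct vertices is encoded by its increasing
   enumeration, so that every subset of [vpair n] is a simple graph on 'I_n and
   each simple graph arises exactly once. *)
Definition vpair (n : nat) : finType :=
  {e : 'I_n * 'I_n | (e.1 < e.2)%N}.

Definition sgraph (n : nat) : finType := {set vpair n}.

Definition adj (n : nat) (G : sgraph n) (i j : 'I_n) : bool :=
  [exists e in G, (val e == (i, j)) || (val e == (j, i))].

Definition deg_in (n : nat) (G : sgraph n) (S : {set 'I_n}) (i : 'I_n) : nat :=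
  #|[set j in S | adj G i j]|.

Definition min_deg_ge (n : nat) (G : sgraph n) (k : nat) (S : {set 'I_n}) :=
  [forall i in S, (k <= deg_in G S i)%N].

(* Induced subgraphs are identified with their vertex sets; the set of maximal
   cardinality is unique, see [kcoreP]. *)
Definition kcore (n : nat) (G : sgraph n) (k : nat) : {set 'I_n} :=
  [arg max_(S > finset.set0 | min_deg_ge G k S) #|S|].

Definition outside_kcore (n : nat) (G : sgraph n) (k : nat) : {set 'I_n} :=
  finset.setC (kcore G k).

(* [true] and [false] stand for the labels +1 and -1. *)
Definition labeling (n : nat) : finType := {ffun 'I_n -> bool}.

Definition edge_prob (R : realType) (n : nat) (p q : R) (sigma : labeling n)
    (e : vpair n) : R :=
  if sigma (val e).1 == sigma (val e).2 then p else q.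

(* Joint law of the labels and the graph: the labels are uniform on {+1,-1}^n,
   and given the labels the edges are independent Bernoulli. This is a
   probability mass function when p and q lie in [0, 1]. *)
Definition SBM_pmf (R : realType) (n : nat) (p q : R)
    (sigma : labeling n) (G : sgraph n) : R :=
  (\prod_(i < n) 2^-1) *
  \prod_(e : vpair n)
    (if e \in G then edge_prob p q sigma e else 1 - edge_prob p q sigma e).

Definition SBM_prob (R : realType) (n : nat) (p q : R)
    (A : pred (sgraph n)) : R :=
  \sum_(sigma : labeling n) \sum_(G : sgraph n | A G) SBM_pmf p q sigma G.

Lemma SBM_pmf_ge0 (R : realType) (n : nat) (p q : R) (sigma : labeling n)
    (G : sgraph n) :
  0 <= p <= 1 -> 0 <= q <= 1 -> 0 <= SBM_pmf p q sigma G.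
Proof.
move=> /andP[p0 p1] /andP[q0 q1]; apply: mulr_ge0.
  by apply: prodr_ge0 => i _; rewrite invr_ge0.
apply: prodr_ge0 => e _; rewrite /edge_prob.
by case: ifP => _; case: ifP => _; rewrite ?subr_ge0.
Qed.

Lemma SBM_prob_total (R : realType) (n : nat) (p q : R) :
  SBM_prob p q (fun _ : sgraph n => true) = 1.
Proof.
rewrite /SBM_prob /SBM_pmf.
under eq_bigr => sigma _.
  rewrite -big_distrr /=.
  have -> : \sum_(G : sgraph n) \prod_(e : vpair n)
      (if e \in G then edge_prob p q sigma e else 1 - edge_prob p q sigma e)
      = 1.
    transitivity (\prod_(e : vpair n)
        (edge_prob p q sigma e + (1 - edge_prob p q sigma e))).
      by rewrite bigA_distr.
    by apply: big1 => e _; rewrite addrC subrK.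
  rewrite mulr1; over.
rewrite sumr_const card_ffun card_bool card_ord prodr_const card_ord.
by rewrite -[LHS]mulr_natl natrX -exprMn mulfV ?expr1n // pnatr_eq0.
Qed.

Lemma kcoreP (n : nat) (G : sgraph n) (k : nat) :
  min_deg_ge G k (kcore G k) /\
  forall S : {set 'I_n}, min_deg_ge G k S -> S \subset kcore G k.
Proof.
rewrite /kcore; case: arg_maxnP => [|K KP Kmax].
  by apply/forall_inP => i; rewrite finset.in_set0.
split=> // S SP.
have deg_mono (A B : {set 'I_n}) i : A \subset B ->
    (k <= deg_in G A i)%N -> (k <= deg_in G B i)%N.
  move=> /fintype.subsetP AB /leq_trans; apply; apply/subset_leq_card/fintype.subsetP => j.
  by rewrite !finset.inE => /andP[/AB -> ->].
have UP : min_deg_ge G k (finset.setU K S).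
  apply/forall_inP => i; rewrite finset.in_setU => /orP[iK|iS].
    by apply: deg_mono (forall_inP KP _ iK); exact: finset.subsetUl.
  by apply: deg_mono (forall_inP SP _ iS); exact: finset.subsetUr.
have /eqP -> : K == finset.setU K S.
  by rewrite eqEcard finset.subsetUl; exact: Kmax.
exact: finset.subsetUr.
Qed.

(* Main.v *)
Require Import Defs.
From mathcomp Require Import all_boot all_order all_algebra.
From mathcomp Require Import all_classical all_reals all_analysis.
From mathcomp Require Import ring lra zify.

Import Order.TTheory GRing.Theory Num.Theory.
Import numFieldNormedType.Exports.

Local Open Scope classical_set_scope.
Local Open Scope ring_scope.

(** Let gamma = (alpha + beta) / 2, let L = ln n, and let F be the set of
    vertices outside the k-core.

    Deleting vertices of degree less than k one at a time never stops before
    all of F is gone.  Stopping after m deletions, where m <= |F|, leaves a set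
    S of exactly m deleted vertices which sends at most (k - 1) m edges to its
    complement: each deleted vertex had at most k - 1 neighbours among the
    vertices still present ([peeling]).  So it is enough to show that with high
    probability no such S exists, for a suitable m.

    This is a first moment computation.  When the two label classes have nearly
    n / 2 vertices each, the expected number of edges leaving S is about
    gamma m L as long as m = o(n) ([expected_cut_ge]); the exponential Markov
    inequality ([bernoulli_chernoff]) then bounds the probability that at most
    (k - 1) m of them are present by roughly (n ^ (- gamma)) ^ m.  There are at
    most (e n / m) ^ m choices of S ([bin_le_expR]), so the expected number of
    bad sets is the m-th power of roughly (n / m) n ^ (- gamma).  For m just
    above n ^ (1 - gamma + eps) this base tends to 0 ([peel_ratio_le]), and since
    m >= 1 so does its m-th power.  All values of gamma are covered at once: when
    gamma > 1 and eps is small, m is 1 and the conclusion is that F is empty.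
    The label classes are balanced with high probability by Chebyshev's
    inequality ([unbalanced_chebyshev]).

    This settles every fixed eps in ]0, gamma[ ([outside_kcore_cvg]); letting eps
    decrease to 0 slowly enough with n ([cvg_diagonal]) gives the o(1) in the
    exponent. *)

(** * Sums of independent Bernoulli variables *)

Definition bernoulli_pmf {R : realType} {T : finType} (w : T -> R)
    (G : {set T}) : R :=
  \prod_(e : T) (if e \in G then w e else 1 - w e).

Lemma bernoulli_pmf_ge0 (R : realType) (T : finType) (w : T -> R) (G : {set T}) :
  (forall e, 0 <= w e <= 1) -> 0 <= bernoulli_pmf w G.
Proof.
move=> w01; apply: prodr_ge0 => e _; have /andP[w0 w1] := w01 e.
by case: ifP => _ //; rewrite subr_ge0.
Qed.

Lemma bernoulli_pmf_total (R : realType) (T : finType) (w : T -> R) :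
  \sum_(G : {set T}) bernoulli_pmf w G = 1.
Proof.
transitivity (\prod_(e : T) (w e + (1 - w e))).
  by rewrite bigA_distr.
by apply: big1 => e _; rewrite addrC subrK.
Qed.

(** Exponential Markov inequality: tilting by z ^ (number of elements of G in C)
    costs a factor z ^- t on the event, and under the product law the tilted
    mass factorizes into terms 1 - (1 - z) w e <= exp (- (1 - z) w e). *)
Lemma bernoulli_chernoff (R : realType) (T : finType) (w : T -> R)
    (C : {set T}) (z : R) (t : nat) :
  (forall e, 0 <= w e <= 1) -> 0 < z <= 1 ->
  \sum_(G : {set T} | (#|finset.setI G C| <= t)%N) bernoulli_pmf w G
    <= z ^- t * expR (- (1 - z) * \sum_(e in C) w e).
Proof.
move=> w01 /andP[z0 z1].
pose c e : R := if e \in C then z else 1.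
have pow_card (G : {set T}) :
    z ^+ #|finset.setI G C| = \prod_(e : T) (if e \in G then c e else 1).
  rewrite -prodr_const big_mkcond /=; apply: eq_bigr => e _.
  by rewrite /c finset.in_setI; case: (e \in G).
have tilt : \sum_(G : {set T}) bernoulli_pmf w G * z ^+ #|finset.setI G C|
    = \prod_(e : T) (w e * c e + (1 - w e)).
  rewrite bigA_distr; apply: eq_bigr => G _.
  rewrite pow_card -big_split /=; apply: eq_bigr => e _.
  by case: (e \in G); rewrite ?mulr1.
rewrite mulrC ler_pdivlMr ?exprn_gt0 //.
apply: (@le_trans _ _
    (\sum_(G : {set T}) bernoulli_pmf w G * z ^+ #|finset.setI G C|)).
  rewrite mulr_suml [leLHS]big_mkcond /=; apply: ler_sum => G _.
  have pG : 0 <= bernoulli_pmf w G by apply: bernoulli_pmf_ge0.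
  case: ifP => [Gt|_]; last by rewrite mulr_ge0 // exprn_ge0 // ltW.
  by rewrite ler_wpM2l // ler_wiXn2l // ltW.
rewrite tilt mulr_sumr expR_sum [leRHS]big_mkcond /=.
apply: ler_prod => e _; have /andP[w0 w1] := w01 e.
rewrite /c; case: ifP => eC; last by rewrite mulr1 addrC subrK ler01 lexx.
apply/andP; split; first by rewrite addr_ge0 ?mulr_ge0 ?subr_ge0 // ltW.
have -> : w e * z + (1 - w e) = 1 + - (1 - z) * w e by ring.
exact: expR_ge1Dx.
Qed.

(** * Edges leaving a set, and peeling *)

Definition cut {n : nat} (S : {set 'I_n}) : {set vpair n} :=
  [set e | ((val e).1 \in S) (+) ((val e).2 \in S)].

Lemma sum_cut (R : realType) (n : nat) (S : {set 'I_n}) (f : 'I_n -> 'I_n -> R) :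
  (forall i j, f i j = f j i) ->
  \sum_(e in cut S) f (val e).1 (val e).2
    = \sum_(i in S) \sum_(j | j \notin S) f i j.
Proof.
move=> fC.
pose g i j : R := if (i \in S) && (j \notin S) then f i j else 0.
have -> : \sum_(e in cut S) f (val e).1 (val e).2 =
    \sum_(u : 'I_n * 'I_n | (u.1 < u.2)%N) (g u.1 u.2 + g u.2 u.1).
  transitivity (\sum_(e : vpair n)
      (g (val e).1 (val e).2 + g (val e).2 (val e).1)); last first.
    symmetry; exact: (big_sub (fun u : 'I_n * 'I_n => (u.1 < u.2)%N)
      (fun u : 'I_n * 'I_n => g u.1 u.2 + g u.2 u.1)).
  rewrite big_mkcond /=; apply: eq_bigr => e _; rewrite finset.inE /g.
  by case: (_ \in S); case: (_ \in S); rewrite /= ?addr0 ?add0r // fC.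
have -> : \sum_(i in S) \sum_(j | j \notin S) f i j =
    \sum_(u : 'I_n * 'I_n) g u.1 u.2.
  rewrite -(pair_bigA _ g) /= big_mkcond /=; apply: eq_bigr => i _.
  rewrite /g; case: (i \in S) => /=; last by rewrite big1.
  by rewrite big_mkcond.
rewrite [RHS](bigID (fun u : 'I_n * 'I_n => (u.1 < u.2)%N)) /= big_split /=.
congr (_ + _).
have swapK : involutive (fun u : 'I_n * 'I_n => (u.2, u.1)) by case.
rewrite (reindex_inj (inv_inj swapK)) /=.
rewrite [LHS]big_mkcond [RHS]big_mkcond /=; apply: eq_bigr => -[i j] _ /=.
rewrite /g -leqNgt; case: ltngtP => // ij.
by rewrite (val_inj ij) andbN.
Qed.

(** An edge incident to i is determined by its other endpoint. *)
Lemma card_incident (n : nat) (G : sgraph n) (T : {set 'I_n}) (i : 'I_n) :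
  (#|[set e in G | ((val e).1 == i) && ((val e).2 \in T)
                 || ((val e).2 == i) && ((val e).1 \in T)]| <= deg_in G T i)%N.
Proof.
set I := [set e in G | _].
pose other (e : vpair n) := if (val e).1 == i then (val e).2 else (val e).1.
have injo : {in I &, injective other}.
  move=> e e'; rewrite !finset.inE /other => /andP[_ He] /andP[_ He'] E.
  apply: val_inj; have := valP e; have := valP e'.
  move: He He' E; case: (val e) => a b; case: (val e') => a' b' /=.
  case: (eqVneq a i) => [->|ai]; case: (eqVneq a' i) => [->|a'i] /=.
  - by move=> _ _ ->.
  - by rewrite /= => _ /andP[/eqP -> _] -> /ltnW; rewrite leqNgt => /negP.
  - by move=> /andP[/eqP -> _] _ -> ? /ltnW; rewrite leqNgt => /negP.
  - by move=> /andP[/eqP -> _] /andP[/eqP -> _] ->.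
rewrite /deg_in -(card_in_imset injo); apply/subset_leq_card/fintype.subsetP => j.
move=> /imsetP[e]; rewrite !finset.inE => /andP[eG He] ->.
rewrite /other /adj; move: He; case: ifP => [/eqP ei|_] /= He.
  have -> : (val e).2 \in T.
    case/orP: He => // /andP[/eqP e2 _].
    by have := valP e; rewrite ei e2 ltnn.
  by apply/exists_inP; exists e => //; rewrite -ei -surjective_pairing eqxx.
case/andP: He => /eqP e2 ->.
by apply/exists_inP; exists e => //; rewrite -e2 -surjective_pairing eqxx orbT.
Qed.

(** While fewer than #|F| vertices have been removed, the remaining set is larger
    than the k-core, so it is not of minimum degree k, and some vertex in it can
    be removed.  The removed vertex i contributes only its edges to the remaining
    vertices as new cut edges; edges from i to S leave the cut. *)
Lemma peeling (n : nat) (G : sgraph n) (k m : nat) :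
  (0 < k)%N -> (m <= #|outside_kcore G k|)%N ->
  exists2 S : {set 'I_n}, #|S| = m & (#|finset.setI G (cut S)| <= k.-1 * m)%N.
Proof.
move=> k0; elim: m => [|m IHm] mF.
  exists finset.set0; first by rewrite finset.cards0.
  rewrite muln0 leqn0 cards_eq0; apply/eqP/finset.setP => e.
  by rewrite !finset.inE andbF.
have [S Sm Scut] := IHm (ltnW mF).
have : ~~ min_deg_ge G k (finset.setC S).
  apply/negP => /(proj2 (kcoreP G k)) /subset_leq_card.
  rewrite leqNgt => /negP; apply.
  have := cardsC S; have := cardsC (kcore G k); rewrite -/(outside_kcore G k) Sm.
  by move: mF; rewrite card_ord; lia.
rewrite negb_forall => /existsP[i]; rewrite negb_imply -ltnNge => /andP[iS degi].
exists (finset.setU (finset.set1 i) S).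
  by move: iS; rewrite finset.in_setC cardsU1 => ->; rewrite Sm.
set I := [set e in G | ((val e).1 == i) && ((val e).2 \in finset.setC S)
                 || ((val e).2 == i) && ((val e).1 \in finset.setC S)].
apply: (@leq_trans (#|finset.setI G (cut S)| + #|I|)%N).
  apply: leq_trans (leq_card_setU _ _); apply/subset_leq_card/fintype.subsetP => e.
  rewrite !finset.inE; case: (e \in G) => //=.
  case: (eqVneq (val e).1 i) => /= [->|_]; case: (eqVneq (val e).2 i) => /= [->|_] //=;
    rewrite ?orbF //; move: iS; rewrite finset.in_setC => /negbTE -> /=.
  - by case: (_ \in S).
  - by case: (_ \in S).
rewrite mulnS addnC leq_add //.
by have := card_incident n G (finset.setC S) i; rewrite -/I; lia.
Qed.

(** * Balance of the labels *)

Definition spin {R : realType} (b : bool) : R := if b then 1 else -1.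

Definition magnetization {R : realType} {n : nat} (sigma : labeling n) : R :=
  \sum_(i < n) spin (sigma i).

(** Orthogonality of distinct spins, by the involution flipping the label of i. *)
Lemma sum_spin_prod (R : realType) (n : nat) (i j : 'I_n) :
  \sum_(sigma : labeling n) spin (sigma i) * spin (sigma j) =
    (if i == j then 2 ^+ n else 0) :> R.
Proof.
case: eqP => [<-|/eqP ij].
  rewrite (eq_bigr (fun=> 1)) => [|sigma _]; last first.
    by rewrite /spin; case: (sigma i); rewrite ?mulr1 // mulrNN mulr1.
  by rewrite sumr_const card_ffun card_bool card_ord natrX.
pose flip (sigma : labeling n) : labeling n :=
  [ffun l => if l == i then ~~ sigma l else sigma l].
have flipK : involutive flip.
  by move=> s; apply/ffunP => l; rewrite !ffunE; case: eqP => // _; rewrite negbK.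
set s := LHS; suff sN : s + s = 0 by lra.
rewrite {1}/s (reindex_inj (inv_inj flipK)) -big_split big1 //= => sigma _.
rewrite !ffunE eqxx eq_sym (negbTE ij) /spin.
by case: (sigma i); rewrite /= ?mulN1r ?mul1r ?opprK ?subrr ?addNr.
Qed.

Lemma sum_magnetization_sqr (R : realType) (n : nat) :
  \sum_(sigma : labeling n) magnetization sigma ^+ 2 = n%:R * 2 ^+ n :> R.
Proof.
under eq_bigr => sigma _ do rewrite expr2 /magnetization big_distrlr /=.
rewrite exchange_big /=; under eq_bigr => i _ do rewrite exchange_big /=.
under eq_bigr => i _ do under eq_bigr => j _ do rewrite sum_spin_prod.
under eq_bigr => i _ do rewrite -big_mkcond /= (big_pred1 i) //.
by rewrite sumr_const card_ord mulr_natl.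
Qed.

Lemma unbalanced_chebyshev (R : realType) (n : nat) (t : R) : 0 < t ->
  \sum_(sigma : labeling n | t < `|magnetization sigma|) 2 ^- n <= n%:R / t ^+ 2.
Proof.
move=> t0; rewrite ler_pdivlMr ?exprn_gt0 //.
rewrite mulr_suml -(@ler_pM2r _ (2 ^+ n)) ?exprn_gt0 // -sum_magnetization_sqr.
rewrite mulr_suml [leLHS]big_mkcond /=; apply: ler_sum => sigma _.
case: ifP => [tlt|_]; last exact: sqr_ge0.
rewrite mulrAC mulVf ?expf_neq0 // mul1r -[leRHS]real_normK ?num_real //.
by apply: lerXn2r; rewrite ?nnegrE ?(ltW t0) ?(ltW tlt).
Qed.

(** The size of a label class is an affine function of the magnetization. *)
Lemma class_size_magnetization (R : realType) (n : nat) (sigma : labeling n)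
    (b : bool) :
  2 * (\sum_(j < n | sigma j == b) 1) = n%:R + spin b * magnetization sigma :> R.
Proof.
have -> : n%:R = \sum_(j < n) 1 :> R by rewrite sumr_const card_ord.
rewrite mulr_sumr mulr_sumr -big_split big_mkcond /=; apply: eq_bigr => j _.
by rewrite /spin; case: (sigma j); case: b => /=; ring.
Qed.

(** Whatever the label of i, one class contributes p and the other q, and both
    have at least n (1/2 - delta) vertices.  The diagonal term j = i is
    kept in the sum: in [expected_cut_ge] it is discarded together with all of S. *)
Lemma expected_degree_ge (R : realType) (n : nat) (p q delta : R)
    (sigma : labeling n) (i : 'I_n) :
  0 <= p -> 0 <= q -> `|magnetization sigma| <= 2 * delta * n%:R ->
  (p + q) * (n%:R * (2^-1 - delta))
    <= \sum_(j < n) (if sigma i == sigma j then p else q).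
Proof.
move=> p0 q0; rewrite ler_norml => /andP[Ml Mu].
rewrite (bigID (fun j => sigma j == sigma i)) /=.
rewrite (eq_bigr (fun=> p * 1)) => [|j /eqP ->]; last by rewrite eqxx mulr1.
rewrite -mulr_sumr mulrDl lerD //.
  apply: ler_wpM2l => //; have := class_size_magnetization R _ sigma (sigma i).
  by rewrite /spin; case: (sigma i); nra.
rewrite (eq_bigl (fun j => sigma j == ~~ sigma i)) => [|j]; last first.
  by case: (sigma i); case: (sigma j).
rewrite (eq_bigr (fun=> q * 1)) => [|j /eqP ->]; last first.
  by case: (sigma i); rewrite /= mulr1.
rewrite -mulr_sumr ler_wpM2l //.
have := class_size_magnetization R _ sigma (~~ sigma i).
by rewrite /spin; case: (sigma i) => /=; nra.
Qed.

Lemma expected_cut_ge (R : realType) (n : nat) (p q delta : R)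
    (sigma : labeling n) (S : {set 'I_n}) :
  0 <= p -> 0 <= q -> `|magnetization sigma| <= 2 * delta * n%:R ->
  #|S|%:R * ((p + q) * (n%:R * (2^-1 - delta) - #|S|%:R))
    <= \sum_(e in cut S) edge_prob p q sigma e.
Proof.
move=> p0 q0 bal.
rewrite (sum_cut _ _ _ (fun i j => if sigma i == sigma j then p else q)); last first.
  by move=> i j; rewrite eq_sym.
rewrite mulr_natl -sumr_const.
apply: ler_sum => i _.
have := expected_degree_ge _ _ _ _ _ _ i p0 q0 bal.
rewrite (bigID (mem S)) /=.
have : \sum_(j in S) (if sigma i == sigma j then p else q) <= (p + q) * #|S|%:R.
  rewrite mulr_natr -sumr_const; apply: ler_sum => j _.
  by case: ifP => _; rewrite ?lerDl ?lerDr.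
by rewrite mulrBr; lra.
Qed.

(** This is C(n, m) <= (e n / m) ^ m, from n ^_ m <= n ^ m and m! >= (m / e) ^ m;
    the latter follows by induction from (1 + 1 / m) ^ m <= e. *)
Lemma bin_le_expR (R : realType) (n m : nat) :
  'C(n, m)%:R * m%:R ^+ m <= (expR 1 * n%:R) ^+ m :> R.
Proof.
have fact_ge : m%:R ^+ m <= expR 1 ^+ m * m`!%:R :> R.
  elim: m => [|m IHm]; first by rewrite !expr0 fact0 mulr1.
  have [->|m0] := posnP m.
    by rewrite !expr1 mulr1; apply: le_trans (expR_ge1Dx _); lra.
  have step : m.+1%:R ^+ m <= expR 1 * m%:R ^+ m :> R.
    have m0' : 0 < m%:R :> R by rewrite ltr0n.
    have -> : m.+1%:R = (1 + m%:R^-1) * m%:R :> R.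
      by rewrite mulrDl mulVf ?mul1r ?natr1 ?nat1r // gt_eqF.
    rewrite exprMn ler_wpM2r ?exprn_ge0 ?ler0n //.
    apply: (@le_trans _ _ (expR m%:R^-1 ^+ m)).
      by apply: lerXn2r; rewrite ?nnegrE ?expR_ge0 ?addr_ge0 ?expR_ge1Dx // invr_ge0 ltW.
    by rewrite -expRM_natl mulfV // gt_eqF.
  rewrite factS natrM exprS exprS mulrCA ler_pM2l ?ltr0n //.
  rewrite -mulrA; apply: le_trans step _.
  by rewrite ler_wpM2l ?expR_ge0.
rewrite exprMn mulrC; apply: le_trans (ler_wpM2r _ fact_ge) _; first exact: ler0n.
rewrite -mulrA ler_wpM2l ?exprn_ge0 ?expR_ge0 // -natrM -natrX ler_nat mulnC.
rewrite bin_ffact ffact_prod -[X in (_ <= _ ^ X)%N]card_ord -prod_nat_const.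
by apply: leq_prod => i _; exact: leq_subr.
Qed.

(** * The first moment bound *)

(** The expected number of sets S of m vertices with at most (k - 1) m outgoing
    edges, given balanced labels, is at most the m-th power of this: e n / m pays
    for the choice of S, and the other two factors come from [bernoulli_chernoff], with
    one m-th of the expected cut of [expected_cut_ge] in the exponent. *)
Definition peel_ratio {R : realType} (n m k : nat) (p q delta z : R) : R :=
  expR 1 * n%:R / m%:R * z ^- k.-1
    * expR (- (1 - z) * ((p + q) * (n%:R * (2^-1 - delta) - m%:R))).

Lemma outside_kcore_first_moment (R : realType) (n k m : nat) (p q delta z : R)
    (sigma : labeling n) :
  (0 < k)%N -> (0 < m)%N -> 0 <= p <= 1 -> 0 <= q <= 1 -> 0 < z <= 1 ->
  `|magnetization sigma| <= 2 * delta * n%:R ->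
  \sum_(G : sgraph n | (m <= #|outside_kcore G k|)%N)
      bernoulli_pmf (edge_prob p q sigma) G
    <= peel_ratio n m k p q delta z ^+ m.
Proof.
move=> k0 m0 p01 q01 z01 bal.
have /andP[p0 _] := p01; have /andP[q0 _] := q01; have /andP[z0 z1] := z01.
have w01 e : 0 <= edge_prob p q sigma e <= 1 by rewrite /edge_prob; case: ifP.
pose few (S : {set 'I_n}) (G : sgraph n) :=
  (#|finset.setI (G : {set vpair n}) (cut S)| <= k.-1 * m)%N.
apply: (@le_trans _ _ (\sum_(G : {set vpair n})
    \sum_(S : {set 'I_n} | #|S| == m)
      (if few S G then bernoulli_pmf (edge_prob p q sigma) G else 0))).
  rewrite big_mkcond /=; apply: ler_sum => G _.
  have pG : 0 <= bernoulli_pmf (edge_prob p q sigma) G by apply: bernoulli_pmf_ge0.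
  have tG S : 0 <= (if few S G then bernoulli_pmf (edge_prob p q sigma) G else 0).
    by case: ifP.
  case: ifP => [mF|_]; last by apply: sumr_ge0.
  have [S Sm Scut] := peeling _ _ _ _ k0 mF.
  rewrite (bigD1 S) ?Sm //= {1}/few Scut lerDl.
  by apply: sumr_ge0.
rewrite exchange_big /=.
pose b := z ^- k.-1
  * expR (- (1 - z) * ((p + q) * (n%:R * (2^-1 - delta) - m%:R))).
apply: (@le_trans _ _ (\sum_(S : {set 'I_n} | #|S| == m) b ^+ m)).
  apply: ler_sum => S /eqP Sm; rewrite -big_mkcond /=.
  apply: le_trans (bernoulli_chernoff _ _ _ (cut S) z _ w01 z01) _.
  rewrite /b exprMn exprVn -exprM ler_pM2l ?invr_gt0 ?exprn_gt0 //.
  rewrite -expRM_natl ler_expR.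
  have := expected_cut_ge _ _ _ _ _ _ S p0 q0 bal; rewrite Sm => cutS.
  rewrite mulrCA !mulNr lerN2 ler_wpM2l ?subr_ge0 //.
rewrite sumr_const; have -> : #|[pred S : {set 'I_n} | #|S| == m]| = 'C(n, m).
  by rewrite -[X in 'C(X, _)]card_ord -card_draws; apply: eq_card => S; rewrite !finset.inE.
have -> : peel_ratio n m k p q delta z = expR 1 * n%:R / m%:R * b.
  by rewrite /peel_ratio /b -!mulrA.
rewrite -[leLHS]mulr_natl [leRHS]exprMn ler_wpM2r //.
  by rewrite exprn_ge0 // mulr_ge0 ?expR_ge0 // invr_ge0 exprn_ge0 // ltW.
by rewrite expr_div_n ler_pdivlMr ?exprn_gt0 ?ltr0n // bin_le_expR.
Qed.

(** Averaging over the labels: balanced labelings satisfy the first moment bound,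
    the others have total mass at most 1 / (4 delta ^ 2 n). *)
Lemma SBM_prob_outside_kcore_ge (R : realType) (n k m : nat) (p q delta z : R) :
  (0 < n)%N -> (0 < k)%N -> (0 < m)%N -> 0 <= p <= 1 -> 0 <= q <= 1 ->
  0 < z <= 1 -> 0 < delta ->
  SBM_prob p q (fun G : sgraph n => (m <= #|outside_kcore G k|)%N)
    <= peel_ratio n m k p q delta z ^+ m + (4 * delta ^+ 2 * n%:R)^-1.
Proof.
move=> n0 k0 m0 p01 q01 z01 d0.
have n0' : 0 < n%:R :> R by rewrite ltr0n.
have /andP[z0 z1] := z01.
have w01 sigma e : 0 <= @edge_prob R n p q sigma e <= 1.
  by rewrite /edge_prob; case: ifP.
have ratio_ge0 : 0 <= peel_ratio n m k p q delta z ^+ m.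
  by rewrite exprn_ge0 // /peel_ratio !mulr_ge0 ?expR_ge0 ?invr_ge0
    ?ler0n ?exprn_ge0 ?(ltW z0).
pose law (sigma : labeling n) := \sum_(G : sgraph n | (m <= #|outside_kcore G k|)%N)
      bernoulli_pmf (edge_prob p q sigma) G.
have law1 sigma : law sigma <= 1.
  rewrite -(bernoulli_pmf_total R _ (edge_prob p q sigma)) /law big_mkcond /=.
  apply: ler_sum => G _; case: ifP => _ //; exact: bernoulli_pmf_ge0.
have -> : SBM_prob p q (fun G : sgraph n => (m <= #|outside_kcore G k|)%N)
    = \sum_(sigma : labeling n) 2 ^- n * law sigma.
  apply: eq_bigr => sigma _; rewrite /law mulr_sumr; apply: eq_bigr => G _.
  by rewrite /SBM_pmf prodr_const card_ord exprVn.
have half0 : 0 <= 2 ^- n :> R by rewrite invr_ge0 exprn_ge0.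
rewrite (bigID (fun sigma => 2 * delta * n%:R < `|magnetization sigma|)) /= addrC.
apply: lerD.
  apply: (@le_trans _ _ (\sum_(sigma : labeling n)
      2 ^- n * peel_ratio n m k p q delta z ^+ m)).
    rewrite big_mkcond /=; apply: ler_sum => sigma _.
    case: ifP => [|_]; last exact: mulr_ge0.
    rewrite -leNgt => bal; rewrite ler_wpM2l //.
    exact: outside_kcore_first_moment.
  rewrite sumr_const card_ffun card_bool card_ord -[leLHS]mulr_natl natrX mulrA.
  by rewrite mulfV ?mul1r // expf_neq0.
have t0 : 0 < 2 * delta * n%:R by rewrite !mulr_gt0.
apply: (@le_trans _ _ (n%:R / (2 * delta * n%:R) ^+ 2)).
  apply: le_trans (unbalanced_chebyshev _ n _ t0); apply: ler_sum => sigma _.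
  by rewrite ler_piMr.
have -> // : n%:R / (2 * delta * n%:R) ^+ 2 = (4 * delta ^+ 2 * n%:R)^-1.
by field; rewrite ?gt_eqF.
Qed.

(** * Asymptotics for a fixed loss in the exponent *)

Lemma near_expRN_ln (R : realType) (c e : R) : 0 < c -> 0 < e ->
  \forall n \near \oo, expR (- (c * ln n%:R)) <= e.
Proof.
move=> c0 e0; near=> n.
rewrite -[leRHS]lnK ?posrE // ler_expR lerNl -ler_pdivrMl // -[leLHS]expRK ler_ln ?posrE ?expR_gt0 ?ltr0n //.
  near: n; exact: nbhs_infty_ger.
near: n; exact: nbhs_infty_gt.
Unshelve. all: by end_near. Qed.

(** Writing 1 / n = x ^ 2 with x = exp (- L / 2), the bound L x <= 2 comes from
    1 + L / 2 <= exp (L / 2), and the remaining factor x tends to 0. *)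
Lemma near_ln_div_nat (R : realType) (a : R) : 0 < a ->
  \forall n \near \oo, 0 <= a * ln n%:R / n%:R <= 1.
Proof.
move=> a0; near=> n.
have n0 : 0 < n%:R :> R by rewrite ltr0n; near: n; exact: nbhs_infty_gt.
have L0 : 0 <= ln n%:R :> R by rewrite ln_ge0 // ler1n -(ltr0n R) ?n0.
have n0x : n%:R \is @Num.pos R by rewrite posrE.
apply/andP; split; first by rewrite divr_ge0 ?mulr_ge0 // ltW.
have H : expR (- (2^-1 * ln n%:R)) <= (2 * a)^-1.
  near: n; apply: near_expRN_ln => //; rewrite invr_gt0; lra.
rewrite -[X in _ / X](lnK n0x) -expRN.
have -> : - ln n%:R = - (2^-1 * ln n%:R) - (2^-1 * ln n%:R) :> R by lra.
have e0 := expR_gt0 (- (2^-1 * ln n%:R) : R).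
have : (1 + 2^-1 * ln n%:R) * expR (- (2^-1 * ln n%:R)) <= 1 :> R.
    apply: le_trans (ler_wpM2r (ltW e0) (expR_ge1Dx _)) _.
  by rewrite expRxMexpNx_1.
rewrite expRD; move: H e0; set x := expR _ => H e0 H1.
have Lx : ln n%:R * x <= 2 by lra.
have : a * (ln n%:R * x * x) <= a * (2 * (2 * a)^-1).
  rewrite ler_pM2l //; apply: ler_pM => //; [exact: mulr_ge0 (ltW _) | exact: ltW].
have -> : a * (2 * (2 * a)^-1) = 1 by field; rewrite gt_eqF.
by rewrite !mulrA.
Unshelve. all: by end_near. Qed.

(** With m / n <= delta, the exponent of the drift factor is at least
    gamma L (1 - delta) (1 - 4 delta) >= gamma L (1 - 5 delta).  The value
    delta = eps / (10 gamma) makes the loss 5 gamma delta equal to eps / 2, while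
    n / m <= n ^ (gamma - eps) gains eps; a factor n ^ (- eps / 2) is left.  The
    same delta serves as tilting parameter z and as tolerance for imbalance. *)
Lemma peel_ratio_le (R : realType) (alpha beta gamma delta eps : R)
    (n m k : nat) :
  gamma = (alpha + beta) / 2 ->
  0 < gamma -> 0 < eps -> delta = eps / (10 * gamma) -> delta <= 1 ->
  (0 < n)%N -> n%:R `^ (1 - gamma + eps) <= m%:R -> m%:R <= delta * n%:R ->
  peel_ratio n m k (alpha * ln n%:R / n%:R) (beta * ln n%:R / n%:R) delta delta
    <= expR 1 * delta ^- k.-1 * expR (- (eps / 2 * ln n%:R)).
Proof.
move=> gE g0 eps0 dE d1 n0 mge mle.
have n0' : 0 < n%:R :> R by rewrite ltr0n.
have n0x : n%:R \is @Num.pos R by rewrite posrE.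
have d0 : 0 < delta by rewrite dE divr_gt0 ?mulr_gt0 ?ltr0n.
have x0 : 0 < n%:R `^ (1 - gamma + eps) by rewrite powR_gt0.
have m0 : 0 < m%:R :> R by exact: lt_le_trans mge.
have L0 : 0 <= ln n%:R :> R by rewrite ln_ge0 // ler1n.
have nm : n%:R / m%:R <= expR ((gamma - eps) * ln n%:R).
  rewrite ler_pdivrMr //; apply: le_trans (ler_wpM2l (expR_ge0 _) mge).
  rewrite /powR gt_eqF // -expRD -{1}(lnK n0x) ler_expR; lra.
have drift : (gamma - eps / 2) * ln n%:R <=
    (1 - delta) * ((alpha * ln n%:R / n%:R + beta * ln n%:R / n%:R) *
       (n%:R * (2^-1 - delta) - m%:R)).
  have -> : alpha * ln n%:R / n%:R + beta * ln n%:R / n%:R = 2 * gamma * ln n%:R / n%:R.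
    by rewrite gE; field; rewrite gt_eqF.
  have -> : 2 * gamma * ln n%:R / n%:R * (n%:R * (2^-1 - delta) - m%:R)
     = 2 * gamma * ln n%:R * (2^-1 - delta - m%:R / n%:R).
    by field; rewrite gt_eqF.
  have mn : m%:R / n%:R <= delta by rewrite ler_pdivrMr.
  have -> : (gamma - eps / 2) * ln n%:R = gamma * ln n%:R * (1 - 5 * delta).
    by rewrite dE; field; rewrite gt_eqF.
  move: mn; set r := m%:R / n%:R => mn; rewrite -subr_ge0.
  (* The difference is put in a form whose sign is visible from r <= delta. *)
  have -> : (1 - delta) * (2 * gamma * ln n%:R * (2^-1 - delta - r))
      - gamma * ln n%:R * (1 - 5 * delta)
    = gamma * ln n%:R * (2 * ((1 - delta) * (delta - r)) + 4 * delta ^+ 2).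
    by field.
  apply: mulr_ge0; first by rewrite mulr_ge0 // ltW.
  have : 0 <= (1 - delta) * (delta - r) by rewrite mulr_ge0 // subr_ge0.
  by have := sqr_ge0 delta; lra.
have zk0 : 0 < delta ^- k.-1 by rewrite invr_gt0 exprn_gt0.
have -> : - (eps / 2 * ln n%:R) =
    (gamma - eps) * ln n%:R + - ((gamma - eps / 2) * ln n%:R) :> R by field.
rewrite /peel_ratio mulNr expRD mulrA -[_ * _ / m%:R]mulrA.
apply: ler_pM; rewrite ?ler_expR ?lerN2 ?expR_ge0 //.
  by rewrite !mulr_ge0 ?expR_ge0 ?invr_ge0 ?ler0n ?exprn_ge0 ?(ltW d0).
by rewrite mulrAC ler_wpM2l // ?ler_wpM2l ?mulr_ge0 ?expR_ge0 ?ltW.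
Qed.

Lemma SBM_probC (R : realType) (n : nat) (p q : R) (A : pred (sgraph n)) :
  SBM_prob p q A = 1 - SBM_prob p q (fun G => ~~ A G).
Proof.
apply/eqP; rewrite -subr_eq opprK -(SBM_prob_total n p q) /SBM_prob -big_split /=.
by apply/eqP; apply: eq_bigr => sigma _; rewrite [RHS](bigID A).
Qed.

Lemma SBM_prob_le (R : realType) (n : nat) (p q : R) (A B : pred (sgraph n)) :
  0 <= p <= 1 -> 0 <= q <= 1 -> {subset A <= B} ->
  0 <= SBM_prob p q A <= SBM_prob p q B.
Proof.
move=> p01 q01 AB; rewrite /SBM_prob sumr_ge0 /=; last first.
  by move=> sigma _; apply: sumr_ge0 => G _; exact: SBM_pmf_ge0.
apply: ler_sum => sigma _; rewrite [leLHS]big_mkcond [leRHS]big_mkcond /=.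
apply: ler_sum => G _; have pG := SBM_pmf_ge0 sigma G p01 q01.
case: ifP => [/AB|_]; first by rewrite unfold_in => ->.
by case: ifP.
Qed.

(** The least integer m exceeding n ^ (1 - gamma + eps) is at least 1 and, because
    eps < gamma, at most delta n for large n.  Hence the peeling ratio is
    eventually at most 1, and its m-th power is at most the ratio itself. *)
Lemma outside_kcore_cvg (R : realType) (alpha beta gamma eps : R) (k : nat) :
  0 < alpha -> 0 < beta -> (0 < k)%N -> gamma = (alpha + beta) / 2 ->
  0 < eps < gamma ->
  SBM_prob (alpha * ln n%:R / n%:R) (beta * ln n%:R / n%:R)
     (fun G : sgraph n =>
        (#|outside_kcore G k|%:R : R) <= n%:R `^ (1 - gamma + eps))
    @[n --> \oo] --> (1 : R).
Proof.
move=> a0 b0 k0 gE /andP[eps0 epsg].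
have g0 : 0 < gamma by exact: lt_trans epsg.
have [delta dE] : exists delta, delta = eps / (10 * gamma) by eexists.
have d0 : 0 < delta by rewrite dE divr_gt0 // mulr_gt0.
have d1 : delta <= 1 by rewrite dE ler_pdivrMr ?mulr_gt0 //; lra.
have [c cE] : exists c, c = expR 1 * delta ^- k.-1 by eexists.
have c0 : 0 < c by rewrite cE mulr_gt0 ?expR_gt0 ?invr_gt0 ?exprn_gt0.
apply/cvgrPdist_le => e e0; near=> n.
have n0 : (0 < n)%N by near: n; exact: nbhs_infty_gt.
have n0' : 0 < n%:R :> R by rewrite ltr0n.
have : 0 <= alpha * ln n%:R / n%:R <= 1 by near: n; exact: near_ln_div_nat.
have : 0 <= beta * ln n%:R / n%:R <= 1 by near: n; exact: near_ln_div_nat.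
set p := alpha * _ / _; set q := beta * _ / _; move=> q01 p01.
set A := fun G : sgraph n => _.
pose x : R := n%:R `^ (1 - gamma + eps).
have x0 : 0 <= x by exact: powR_ge0.
pose m := (Num.truncn x).+1.
have /andP[mx xm] := truncn_itv x0.
have mn : m%:R <= delta * n%:R.
  have -> : m%:R = (Num.truncn x)%:R + 1 :> R by rewrite natr1.
  have xn : expR (- ((gamma - eps) * ln n%:R)) <= delta / 2.
    near: n; apply: near_expRN_ln; first by rewrite subr_gt0.
    exact: divr_gt0.
  have dn : 1 <= delta / 2 * n%:R.
    rewrite -ler_pdivrMl ?divr_gt0 // mulr1; near: n; exact: nbhs_infty_ger.
  have xE : x = expR (- ((gamma - eps) * ln n%:R)) * n%:R.
    rewrite /x /powR gt_eqF // -{3}(@lnK _ n%:R) ?posrE // -expRD.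
    by congr expR; ring.
  have : x <= delta / 2 * n%:R by rewrite xE ler_pM2r.
  by lra.
have ratio := peel_ratio_le _ _ _ _ delta _ _ m k gE g0 eps0 dE d1 n0 (ltW xm) mn; rewrite -cE in ratio.
have small : expR (- (eps / 2 * ln n%:R)) <= Num.min c^-1 (e / 2 / c).
  near: n; apply: near_expRN_ln; first exact: divr_gt0.
  by rewrite lt_min invr_gt0 c0 !divr_gt0.
have unbal : (4 * delta ^+ 2 * n%:R)^-1 <= e / 2.
  rewrite -[leRHS]invrK lef_pV2 ?posrE ?invr_gt0 ?divr_gt0 ?mulr_gt0 ?exprn_gt0 //.
  rewrite -ler_pdivrMl ?mulr_gt0 ?exprn_gt0 //.
  near: n; exact: nbhs_infty_ger.
have ratio_ge0 : 0 <= peel_ratio n m k p q delta delta.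
  by rewrite /peel_ratio !mulr_ge0 ?expR_ge0 ?invr_ge0 ?ler0n ?exprn_ge0 ?(ltW d0).
have ratio1 : peel_ratio n m k p q delta delta <= 1.
  apply: le_trans ratio _; rewrite mulrC -ler_pdivlMr // div1r.
  by apply: le_trans small _; rewrite ge_min lexx.
have ratioe : peel_ratio n m k p q delta delta <= e / 2.
  apply: le_trans ratio _; rewrite mulrC -ler_pdivlMr //.
  by apply: le_trans small _; rewrite ge_min lexx orbT.
have fail_many : {subset (fun G : sgraph n => ~~ A G)
    <= (fun G : sgraph n => (m <= #|outside_kcore G k|)%N)}.
  move=> G; rewrite !unfold_in /A -ltNge -(ltr_nat R) => xF.
  exact: le_lt_trans mx xF.
have /andP[fail_ge0 fail_le] := SBM_prob_le _ _ _ _ _ _ p01 q01 fail_many.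
rewrite (SBM_probC _ _ _ _ A) opprB addrC subrK ger0_norm //.
apply: le_trans fail_le _.
have d01 : 0 < delta <= 1 by rewrite d0.
apply: le_trans (SBM_prob_outside_kcore_ge _ _ _ m _ _ delta delta n0 k0 isT p01 q01 d01 d0) _.
have -> : e = e / 2 + e / 2 by field.
apply: lerD => //; apply: le_trans _ ratioe.
by rewrite exprS ler_piMr // exprn_ile1.
Unshelve. all: by end_near. Qed.

(** * Letting the loss tend to zero *)

(** If row j is within 1 / (j + 1) of its limit from N j on, follow at time n the
    largest row j < n with N j <= n. *)
Lemma cvg_diagonal (R : realType) (f : nat -> nat -> R) (l : R) :
  (forall j, f j n @[n --> \oo] --> l) ->
  exists2 J : nat -> nat, J n @[n --> \oo] --> \oo &
    f (J n) n @[n --> \oo] --> l.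
Proof.
move=> fl.
have /choice[N NP] j : exists N, forall n, (N <= n)%N -> `|l - f j n| <= harmonic j.
  have /cvgrPdist_le /(_ (harmonic j)) := fl j.
  by move=> /(_ (harmonic_gt0 j)) [N _ HN]; exists N => n; exact: HN.
pose J n := (\max_(j < n | N j <= n) j)%N.
have J_ge M n : (M < n)%N -> (N M <= n)%N -> (M <= J n)%N.
  by move=> Mn NM; exact: (leq_bigmax_cond (Ordinal Mn)).
have J_ok n : (0 < n)%N -> (N 0 <= n)%N -> (N (J n) <= n)%N.
  move=> n0 N0; have [|i iN Ji] := @eq_bigmax_cond _ (fun j : 'I_n => (N j <= n)%N)
      (fun j => j : nat).
    by apply/card_gt0P; exists (Ordinal n0).
  by have -> : J n = i by exact: Ji.
have Joo : J n @[n --> \oo] --> \oo.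
  apply/cvgnyPge => M; near=> n; apply: J_ge; near: n.
    exact: nbhs_infty_gt.
  exact: nbhs_infty_ge.
have hJ : harmonic (J n) @[n --> \oo] --> (0 : R).
  exact: (cvg_comp _ _ Joo cvg_harmonic).
exists J => //; apply/cvgrPdist_le => e e0; near=> n.
apply: le_trans (NP _ _ (J_ok _ _ _)) _.
- by near: n; exact: nbhs_infty_gt.
- by near: n; exact: nbhs_infty_ge.
rewrite -[leLHS]ger0_norm ?harmonic_ge0 // -normrN -[- _]add0r.
by near: n; move/cvgrPdist_le : hJ; apply.
Unshelve. all: by end_near. Qed.

(** The losses epsj j = gamma / (j + 2) lie in ]0, gamma[ and tend to 0. *)
Theorem lemma4p13 (R : realType) (alpha beta : R) (k : nat)
    (alpha_gt0 : 0 < alpha) (beta_gt0 : 0 < beta) (k_ge1 : (1 <= k)%N) :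
  exists eps : nat -> R,
    (eps n @[n --> \oo] --> (0 : R)) /\
    ((SBM_prob (alpha * ln n%:R / n%:R) (beta * ln n%:R / n%:R)
       (fun G : sgraph n =>
          (#|outside_kcore G k|%:R : R)
            <= n%:R `^ (1 - (alpha + beta) / 2 + eps n)))
      @[n --> \oo] --> (1 : R)).
Proof.
set gamma := (alpha + beta) / 2.
have gamma_gt0 : 0 < gamma by rewrite divr_gt0 ?addr_gt0.
pose epsj (j : nat) : R := gamma * harmonic j.+1.
have epsj_bounds j : 0 < epsj j < gamma.
  rewrite /epsj mulr_gt0 ?harmonic_gt0 //= -[ltRHS]mulr1 ltr_pM2l //.
  by rewrite invf_lt1 ?ltr0n // ltr1n.
have [J Joo PJ] := cvg_diagonal _ _ _ (fun j =>
  outside_kcore_cvg _ _ _ gamma (epsj j) _ alpha_gt0 beta_gt0 k_ge1 erefl (epsj_bounds j)).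
exists (epsj \o J); split; last exact: PJ.
have epsj0 : epsj j @[j --> \oo] --> (0 : R).
  rewrite -[X in _ --> X](mulr0 gamma); apply: cvgMr.
  by have := @cvg_harmonic R; rewrite -(cvg_shiftS (@harmonic R)).
exact: (cvg_comp _ _ Joo epsj0).
Qed.
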